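(* For each pair of integers $r,t$ with $1\leq r\leq t$, there exists a non-symmetric digraph $D$ such that $\operatorname{dc}(D)=r$ and $\operatorname{dac}(D)=t$.
   Context: Digraphs are finite, without loops and without parallel arcs (opposite arcs $(u,v)$ and $(v,u)$ may both be present); $V(D)$ and $A(D)$ denote the vertex set and the arc set of $D$. A digraph is symmetric if $(v,u)\in A(D)$ whenever $(u,v)\in A(D)$; it is non-symmetric if it is not symmetric. A coloring of $D$ with $k$ colors is a function $\varphi:V(D)\to[k]=\{1,\dots,k\}$ using all $k$ colors; its chromatic classes are $C_i=\{v\in V(D):\varphi(v)=i\}$. The coloring is acyclic if no chromatic class induces a subdigraph containing a directed cycle (two opposite arcs form a directed cycle of length 2). It is complete if for every ordered pair $(i,j)$ of distinct colors there is at least one arc from a vertex of color $i$ to a vertex of color $j$. The dichromatic number $\operatorname{dc}(D)$ is the minimum number of colors in an acyclic coloring of $D$; the diachromatic number $\operatorname{dac}(D)$ is the maximum number of colors in a complete acyclic coloring of $D$. *)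

(* Defs.v *)
From mathcomp Require Import all_boot.
From mathcomp Require Import boolp.

Set Implicit Arguments.
Unset Strict Implicit.
Unset Printing Implicit Defensive.

Record digraph := Digraph {
  vertex :> finType;
  arc : rel vertex;
  arc_irr : irreflexive arc }.

Definition symmetric_digraph (D : digraph) : Prop :=
  forall u v : D, arc u v -> arc v u.

Definition induced_arc (D : digraph) (S : {set D}) : rel {x : D | x \in S} :=
  fun u v => arc (val u) (val v).

Fact induced_arc_irr (D : digraph) (S : {set D}) :
  irreflexive (@induced_arc D S).
Proof. by move=> u; apply: arc_irr. Qed.

Definition induced (D : digraph) (S : {set D}) : digraph :=
  Digraph (@induced_arc_irr D S).

(* Since there are no loops, such a sequence has at least two vertices; two
   opposite arcs form a directed cycle of length 2. *)
Definition dicycle (D : digraph) (c : seq D) : Prop :=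
  c <> [::] /\ ucycle (@arc D) c.

Definition acyclic_digraph (D : digraph) : Prop := ~ exists c : seq D, dicycle c.

(* The colors are 0, ..., k-1 rather than 1, ..., k. *)
Definition is_coloring (D : digraph) (k : nat) (f : D -> 'I_k) : Prop :=
  forall i : 'I_k, exists v : D, f v = i.

Definition color_class (D : digraph) (k : nat) (f : D -> 'I_k) (i : 'I_k) :
  {set D} := [set v | f v == i].

Definition acyclic_coloring (D : digraph) (k : nat) (f : D -> 'I_k) : Prop :=
  is_coloring f /\ forall i : 'I_k, acyclic_digraph (induced (color_class f i)).

Definition complete_coloring (D : digraph) (k : nat) (f : D -> 'I_k) : Prop :=
  forall i j : 'I_k, i <> j ->
    exists u v : D, [/\ f u = i, f v = j & arc u v].

Definition has_acyclic_coloring (D : digraph) (k : nat) : Prop :=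
  exists f : D -> 'I_k, acyclic_coloring f.

Definition has_complete_acyclic_coloring (D : digraph) (k : nat) : Prop :=
  exists f : D -> 'I_k, acyclic_coloring f /\ complete_coloring f.

Lemma acyclic_inducedP (D : digraph) (S : {set D}) :
  acyclic_digraph (induced S) <->
  ~ exists2 c : seq D, dicycle c & {subset c <= S}.
Proof.
split=> acS [].
  move=> c [c0 cc] cS; apply: acS.
  have [c' def_c] : exists c' : seq {x : D | x \in S}, c = map val c'.
    elim: c cS {c0 cc} => [|x c IHc] cS; first by exists [::].
    have /IHc[c' ->] : {subset c <= S}.
      by move=> y yc; apply: cS; rewrite inE yc orbT.
    by exists (exist _ x (cS x (mem_head _ _)) :: c').
  exists c'; split; first by move=> c'0; apply: c0; rewrite def_c c'0.
  move: cc; rewrite def_c /ucycle (map_inj_uniq val_inj) cycle_map => /andP[].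
  by move=> cc uc; apply/andP; split.
move=> c [c0 /andP[cc uc]]; apply: acS; exists (map val c).
  split; first by case: c c0 {cc uc}.
  by rewrite /ucycle (map_inj_uniq val_inj) uc cycle_map andbT.
by move=> _ /mapP[x _ ->]; apply: (valP x).
Qed.

Lemma has_acyclic_coloring_card (D : digraph) : has_acyclic_coloring D #|D|.
Proof.
exists enum_rank; split=> [i|i]; first by exists (enum_val i); rewrite enum_valK.
apply/acyclic_inducedP => -[[|x c] [//= _ /andP[/= cc _]] cS].
have cE y : y \in x :: c -> y = enum_val i.
  by move=> /cS; rewrite inE => /eqP <-; rewrite enum_rankK.
case: c cc cS cE => [|y c] /= + _ cE; first by rewrite arc_irr.
have xc : x \in [:: x, y & c] by rewrite inE eqxx.
have yc : y \in [:: x, y & c] by rewrite !inE eqxx orbT.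
have -> : y = x by exact: etrans (cE y yc) (esym (cE x xc)).
by rewrite arc_irr.
Qed.

Lemma coloring_card (D : digraph) (k : nat) (f : D -> 'I_k) :
  is_coloring f -> k <= #|D|.
Proof.
move=> f_onto; rewrite -[k]card_ord; apply: leq_trans (leq_image_card f D).
by apply/subset_leq_card/subsetP=> i _; have [v <-] := f_onto i; apply: image_f.
Qed.

Lemma acyclic_inducedU (D : digraph) (A B : {set D}) :
    (forall u v, u \in A -> v \in B -> ~~ arc u v) ->
    acyclic_digraph (induced A) -> acyclic_digraph (induced B) ->
  acyclic_digraph (induced (A :|: B)).
Proof.
move=> noAB /acyclic_inducedP acA /acyclic_inducedP acB.
apply/acyclic_inducedP => -[c [c0 /andP[cc uc]] cAB].
have [/hasP[x xc xA]|/hasPn cNA] := boolP (has (mem A) c); last first.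
  apply: acB; exists c => [|y yc]; first by split=> //; apply/andP.
  by have /setUP[yA|//] := cAB y yc; move: (cNA y yc); rewrite /= yA.
apply: acA; have [n c' def_c'] := rot_to xc.
exists c => [|y]; first by split=> //; apply/andP.
rewrite -(mem_rot n) def_c'.
have {cAB} : {subset x :: c' <= A :|: B}.
  by move=> z; rewrite -def_c' mem_rot; apply: cAB.
have : path (@arc D) x c'.
  by move: cc; rewrite -(rot_cycle n) def_c' /= rcons_path => /andP[].
elim: c' x xA {xc def_c'} => [|z c' IHc] x xA /=.
  by rewrite inE => _ _ /eqP->.
move=> /andP[xz zc'] cAB; rewrite inE => /predU1P[-> //|]; apply: IHc => //.
  have := cAB z; rewrite !inE eqxx orbT => /(_ isT) /orP[//|zB].
  by have := noAB x z xA zB; rewrite xz.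
by move=> w wc; apply: cAB; rewrite inE wc orbT.
Qed.

(* If no arc goes from one class to another, the two classes can be merged.
   Hence complete acyclic colorings exist and dac below is a true maximum. *)
Lemma min_acyclic_coloring_complete (D : digraph) (k : nat) (f : D -> 'I_k) :
    acyclic_coloring f -> (forall m, has_acyclic_coloring D m -> k <= m) ->
  complete_coloring f.
Proof.
case: k f => [f _ _ []//|k f [f_onto f_ac] k_min i j /eqP ij].
apply: contrapT => noij.
have [i0 def_i _] : {i0 | i = lift j i0 & unlift j i = Some i0}.
  by apply: unlift_some; rewrite eq_sym.
pose g v := odflt i0 (unlift j (f v)).
have gE v : lift j (g v) = if f v == j then i else f v.
  rewrite /g; case: unliftP => [a ->|->] /=; last by rewrite eqxx.
  by rewrite eq_sym (negPf (neq_lift j a)).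
suff /k_min : has_acyclic_coloring D k by rewrite ltnn.
exists g; split=> a.
  have [v fv] := f_onto (lift j a); exists v; apply: (@lift_inj _ j).
  by rewrite gE fv eq_sym (negPf (neq_lift j a)).
have [->|ai] := eqVneq a i0.
  have -> : color_class g i0 = color_class f i :|: color_class f j.
    apply/setP=> v; rewrite !inE -(inj_eq (@lift_inj _ j)) gE -def_i.
    by have [->|_] := eqVneq (f v) j; rewrite ?eqxx ?orbT ?orbF.
  apply: acyclic_inducedU => // u v; rewrite !inE => /eqP fu /eqP fv.
  by apply/negP=> uv; apply: noij; exists u, v.
have -> : color_class g a = color_class f (lift j a) => //.
apply/setP=> v; rewrite !inE -(inj_eq (@lift_inj _ j)) gE.
have [->|_] := eqVneq (f v) j => //.
by rewrite def_i (inj_eq (@lift_inj _ j)) eq_sym (negPf ai) (negPf (neq_lift j a)).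
Qed.

Fact dc_exists (D : digraph) : exists k, `[< has_acyclic_coloring D k >].
Proof. by exists #|D|; apply/asboolP/has_acyclic_coloring_card. Qed.

Definition dc (D : digraph) : nat := ex_minn (dc_exists D).

Fact dac_exists (D : digraph) :
  exists k, `[< has_complete_acyclic_coloring D k >].
Proof.
have [k /asboolP[f f_ac] k_min] := ex_minnP (dc_exists D).
exists k; apply/asboolP; exists f; split=> //.
by apply: min_acyclic_coloring_complete => // m Dm; apply: k_min; apply/asboolP.
Qed.

Fact dac_bounded (D : digraph) (k : nat) :
  `[< has_complete_acyclic_coloring D k >] -> k <= #|D|.
Proof. by move=> /asboolP[f [[f_onto _] _]]; apply: coloring_card f_onto. Qed.

Definition dac (D : digraph) : nat :=
  ex_maxn (dac_exists D) (@dac_bounded D).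

(* Main.v *)
Require Import Defs.
From mathcomp Require Import all_boot.
From mathcomp Require Import boolp zify.

(** A complete coloring with [k] colors needs a different arc for each of the
    [k * (k - 1)] ordered pairs of distinct colors, so [dac] is bounded by the
    number of arcs ([complete_coloring_arcs]).  The digraph below attains this
    bound.  Up to isolated vertices, it is the disjoint union of the complete
    symmetric digraph on [r] vertices and of isolated one-way arcs: one for each
    ordered pair of distinct elements of [0, t) that is not already joined
    inside the clique, and one more.

    - Identifying the clique with [0, r) and coloring the ends of each isolated
      arc by its pair gives a complete coloring with [t] colors.  There are only
      [t * (t - 1) + 1] arcs, fewer than the [(t + 1) * t] that [t + 1] colors
      would need, since [0 < t]; hence [dac = t].
    - Directed cycles live in the clique, because an end of an isolated arc is
      a source or a sink.  So a coloring is acyclic exactly when it is injective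
      on the clique, and [dc = r].
    - The additional one-way arc makes the digraph non-symmetric even when
      [r = t], and the count above leaves room for it. *)

Set Implicit Arguments.
Unset Strict Implicit.
Unset Printing Implicit Defensive.

Definition offdiag (k : nat) : {set 'I_k * 'I_k} := [set p | p.1 != p.2].

Definition arcs (D : digraph) : {set D * D} := [set e | Defs.arc e.1 e.2].

Lemma card_offdiag (k : nat) : #|offdiag k| = k * k.-1.
Proof.
have card_diag : #|~: offdiag k| = k.
  rewrite (_ : ~: offdiag k = [set (i, i) | i : 'I_k]).
    by rewrite card_imset ?card_ord // => i j [].
  apply/setP=> -[i j]; rewrite !inE negbK /=.
  by apply/eqP/imsetP=> [->|[l _ [-> ->]]] //; exists j.
have := cardsC (offdiag k); rewrite card_diag card_prod !card_ord; nia.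
Qed.

Lemma complete_coloring_arcs (D : digraph) (k : nat) (f : D -> 'I_k) :
  complete_coloring f -> k * k.-1 <= #|arcs D|.
Proof.
move=> f_complete; rewrite -card_offdiag.
apply: leq_trans (leq_imset_card (fun e => (f e.1, f e.2)) (arcs D)).
apply/subset_leq_card/subsetP=> -[i j]; rewrite inE => /eqP ij.
have [u [v [fu fv uv]]] := f_complete i j ij.
by apply/imsetP; exists (u, v); rewrite ?inE //= fu fv.
Qed.

Section CliqueAndArcs.

Variables r t : nat.

(** The vertices [(p, false)] and [(p, true)] are the tail and the head of the
    isolated arc of the pair [p]; they have no incident arc when [p] does not
    satisfy [has_isolated_arc]. *)
Definition ca_vertex : finType := ('I_r + 'I_t * 'I_t * bool)%type.

(* The pair (0, 0) carries the additional arc. *)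
Definition has_isolated_arc (p : 'I_t * 'I_t) : bool :=
  if p.1 == p.2 then p.1 == 0 :> nat else ~~ ((p.1 < r) && (p.2 < r)).

Definition ca_arc : rel ca_vertex := fun u v =>
  match u, v with
  | inl i, inl j => i != j
  | inr (p, false), inr (q, true) => (p == q) && has_isolated_arc p
  | _, _ => false
  end.

Fact ca_arc_irr : irreflexive ca_arc.
Proof. by case=> [i|[p []]] //=; rewrite eqxx. Qed.

Definition clique_and_arcs : digraph := Digraph ca_arc_irr.

Definition clique_vertex (i : 'I_r) : clique_and_arcs := inl i.

Lemma clique_and_arcs_not_symmetric :
  0 < t -> ~ symmetric_digraph clique_and_arcs.
Proof.
move=> t_gt0; pose p := (Ordinal t_gt0, Ordinal t_gt0).
by move=> /(_ (inr (p, false)) (inr (p, true))) /= /(_ isT).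
Qed.

(** The middle vertex is neither a source nor a sink, so it is not an end of an
    isolated arc. *)
Lemma dipath2_clique (u v w : clique_and_arcs) :
    Defs.arc u v -> Defs.arc v w ->
  exists i j, [/\ i != j, v = clique_vertex i & w = clique_vertex j].
Proof.
by case: u v w => [l|[p []]] [i|[q []]] [j|[q' b]] //= _ ij; exists i, j.
Qed.

Lemma dicycle_clique (c : seq clique_and_arcs) :
    dicycle c ->
  exists i j, [/\ i != j, clique_vertex i \in c & clique_vertex j \in c].
Proof.
case: c => [[]//|x c] [_ /andP[cc _]]; set s := x :: c in cc *.
have xs : x \in s := mem_head x c.
have ys : next s x \in s by rewrite mem_next.
have [i [j [ij def_y def_z]]] :=
  dipath2_clique (next_cycle cc xs) (next_cycle cc ys).
by exists i, j; rewrite -def_z -def_y !mem_next.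
Qed.

Lemma clique_injective_acyclic (k : nat) (f : clique_and_arcs -> 'I_k) :
  injective (f \o clique_vertex) ->
  forall a, acyclic_digraph (induced (color_class f a)).
Proof.
move=> f_inj a; apply/acyclic_inducedP => -[c /dicycle_clique[i [j [ij ic jc]]]].
move=> cS; move/eqP: ij; apply; apply: f_inj => /=.
by move: (cS _ ic) (cS _ jc); rewrite !inE => /eqP-> /eqP->.
Qed.

Lemma acyclic_clique_injective (k : nat) (f : clique_and_arcs -> 'I_k) :
  acyclic_coloring f -> injective (f \o clique_vertex).
Proof.
move=> [_ f_ac] i j /= fij; apply/eqP/negPn/negP=> ij.
have /acyclic_inducedP := f_ac (f (clique_vertex i)); apply.
exists [:: clique_vertex i; clique_vertex j].
  by split=> //; rewrite /ucycle /= inE ij (eq_sym j) ij.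
by move=> v; rewrite !inE => /orP[]/eqP->; rewrite ?fij.
Qed.

Lemma dc_clique_and_arcs : 0 < r -> dc clique_and_arcs = r.
Proof.
move=> r_gt0; rewrite /dc; case: ex_minnP => k /asboolP[f f_ac] k_min.
apply/eqP; rewrite eqn_leq; apply/andP; split; last first.
  by have := leq_card _ (acyclic_clique_injective f_ac); rewrite !card_ord.
apply/k_min/asboolP.
exists (fun v : clique_and_arcs => if v is inl i then i else Ordinal r_gt0).
by split=> [i|]; [exists (clique_vertex i) | apply: clique_injective_acyclic].
Qed.

Hypothesis le_rt : r <= t.

Definition pair_coloring (v : clique_and_arcs) : 'I_t :=
  match v with
  | inl i => widen_ord le_rt i
  | inr (p, b) => if b then p.2 else p.1
  end.

Lemma pair_coloring_acyclic : acyclic_coloring pair_coloring.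
Proof.
split=> [i|]; first by exists (inr ((i, i), false)).
by apply: clique_injective_acyclic => i j /(congr1 val) /= /val_inj.
Qed.

Lemma pair_coloring_complete : complete_coloring pair_coloring.
Proof.
move=> i j /eqP ij; case: (boolP ((i < r) && (j < r))) => [/andP[ir jr]|ij_r].
  exists (clique_vertex (Ordinal ir)), (clique_vertex (Ordinal jr)).
  by split=> //; apply: val_inj.
exists (inr ((i, j), false)), (inr ((i, j), true)).
by split=> //=; rewrite eqxx /has_isolated_arc /= (negPf ij).
Qed.

(** The pair of colors of its ends determines an arc: a pair either is joined
    in the clique or has an isolated arc, never both.  These pairs lie off the
    diagonal, except the pair (0, 0) of the additional arc. *)
Lemma card_arcs_clique_and_arcs : #|arcs clique_and_arcs| <= (t * t.-1).+1.
Proof.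
pose ends (e : clique_and_arcs * clique_and_arcs) :=
  (pair_coloring e.1, pair_coloring e.2).
have widen_eq (i j : 'I_r) :
    (widen_ord le_rt i == widen_ord le_rt j) = (i == j) by [].
have ends_inj : {in arcs clique_and_arcs &, injective ends}.
  move=> [[i|[p []]] [j|[q []]]] [[i'|[p' []]] [j'|[q' []]]]; rewrite !inE //=.
  - by move=> _ _ [] /val_inj-> /val_inj->.
  - move=> ij /andP[/eqP<- +] [/= def1 def2].
    by rewrite /has_isolated_arc -def1 -def2 widen_eq (negPf ij) /= !ltn_ord.
  - move=> /andP[/eqP<- +] ij [/= def1 def2].
    by rewrite /has_isolated_arc def1 def2 widen_eq (negPf ij) /= !ltn_ord.
  move=> /andP[/eqP<- _] /andP[/eqP<- _] [/= def1 def2].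
  by case: p p' def1 def2 => [i j] [i' j'] /= -> ->.
rewrite -(card_in_imset ends_inj) -card_offdiag.
pose origin : {set 'I_t * 'I_t} :=
  [set p : 'I_t * 'I_t | (p.1 == 0 :> nat) && (p.2 == 0 :> nat)].
have origin_le1 : #|origin| <= 1.
  apply/card_le1_eqP=> -[i j] [i' j']; rewrite !inE /=.
  move=> /andP[/eqP i0 /eqP j0] /andP[/eqP i'0 /eqP j'0].
  by congr (_, _); apply: val_inj; rewrite /= ?i0 ?j0 ?i'0 ?j'0.
have sub : ends @: arcs clique_and_arcs \subset offdiag t :|: origin.
  apply/subsetP=> _ /imsetP[[u v] uv ->]; move: uv; rewrite !inE.
  case: u v => [i|[p []]] [j|[q []]] //=; first by rewrite widen_eq => ->.
  move=> /andP[/eqP <-]; rewrite /has_isolated_arc.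
  by case: eqP => //= <- ->.
apply: leq_trans (subset_leq_card sub) _.
apply: leq_trans (leq_card_setU _ _) _.
by rewrite -[leqRHS]addn1 leq_add2l.
Qed.

Lemma dac_clique_and_arcs : 0 < t -> dac clique_and_arcs = t.
Proof.
move=> t_gt0; rewrite /dac; case: ex_maxnP => k /asboolP[f [_ f_complete]] k_max.
apply/eqP; rewrite eqn_leq; apply/andP; split; last first.
  apply/k_max/asboolP; exists pair_coloring.
  by split; [apply: pair_coloring_acyclic | apply: pair_coloring_complete].
have le_k := leq_trans (complete_coloring_arcs f_complete)
  card_arcs_clique_and_arcs.
rewrite leqNgt; apply/negP=> lt_tk.
have : t.+1 * t <= k * k.-1 by apply: leq_mul; lia.
nia.
Qed.

End CliqueAndArcs.

Theorem theorem10 (r t : nat) (hr : 1 <= r) (hrt : r <= t) :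
  exists D : digraph, [/\ ~ symmetric_digraph D, dc D = r & dac D = t].
Proof.
have t_gt0 : 0 < t := leq_trans hr hrt.
exists (clique_and_arcs r t); split.
- exact: clique_and_arcs_not_symmetric.
- exact: dc_clique_and_arcs.
- exact: dac_clique_and_arcs.
Qed.
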